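(* Let $n$ be a positive integer, let $m_1,\dots,m_n$ be positive integers, and let $g_n=\chi_1*\chi_2*\cdots*\chi_n$ be the probability mass function of the sum $\sum_{j=1}^nX_j$ of independent random variables $X_j$, with $X_j$ uniformly distributed on the $2m_j+1$ integers in $[-m_j,m_j]$. Then for all integers $p$, $$g_n(p)=\frac{M}{2^n}\sum_{\vec\varepsilon\in\{-1,1\}^n}\mathrm{sign}\Big(2p+\sum_{j=1}^n(2m_j+1)\varepsilon_j\Big)\Big(\prod_{j=1}^n\varepsilon_j\Big)\sum_{0\le k\le (n-1)/2}(-1)^k\,b_{2k}^{(n)}\,\frac{\Big(2p+\sum_{j=1}^n(2m_j+1)\varepsilon_j\Big)^{n-2k-1}}{(n-2k-1)!},$$ where the outer sum is over all $2^n$ vectors of signs $\vec\varepsilon=(\varepsilon_1,\dots,\varepsilon_n)$, the inner sum is over integers $k$, $$M:=\prod_{j=1}^n(2m_j+1)^{-1},$$ and the rational numbers $b_{2k}^{(n)}$ are the coefficients in the Laurent series expansion (about $x=0$) $$\Big(\frac{1}{\sin x}\Big)^n=\sum_{k=0}^\infty x^{2k-n}\,b_{2k}^{(n)}.$$ Explicitly, for all integers $k\ge 0$, $$b_{2k}^{(n)}=(-1)^k\binom{n+2k}{n}\sum_{m=0}^{2k}\frac{n}{n+m}\binom{2k}{m}\frac{1}{2^m(2k+m)!}\sum_{r=0}^m(-1)^r\binom{m}{r}(2r-m)^{2k+m}.$$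
   Context: The mass function of $X_j$ is the function $\chi_j$ of an integer variable given by $(2m_j+1)\chi_j(p)=1$ if $|p|\le m_j$ and $(2m_j+1)\chi_j(p)=0$ if $|p|>m_j$. The $n$-fold convolution is $g_n(p)=(\chi_1*\cdots*\chi_n)(p)=\sum_{k_1+k_2+\cdots+k_n=p}\prod_{j=1}^n\chi_j(k_j)$, the sum being over all integers $k_1,\dots,k_n$ with $k_1+\cdots+k_n=p$. The function $\mathrm{sign}$ is defined by $\mathrm{sign}(y)=1$ if $y>0$, $\mathrm{sign}(0)=0$, and $\mathrm{sign}(y)=-1$ if $y<0$. The convention $0^0=1$ is used. *)

(* Defs.v *)
From HB Require Import structures.
From mathcomp Require Import all_boot all_order all_algebra.
From mathcomp Require Import all_classical all_reals all_analysis.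
Import Order.TTheory GRing.Theory Num.Theory.
Import numFieldNormedType.Exports.

Set Implicit Arguments.
Unset Strict Implicit.
Unset Printing Implicit Defensive.

Local Open Scope classical_set_scope.
Local Open Scope ring_scope.

Definition chi (R : realType) (m : nat) (p : int) : R :=
  if `|p| <= m%:Z then ((2 * m + 1)%N%:R)^-1 else 0.

(* [\sum_(k \in A) F k] is the finitely supported sum over the (infinite) set
   A, with value 0 if the support is infinite: this is the n-fold convolution
   only for finitely supported f j, such as the functions [chi R (m j)]. *)
Definition convolution (R : realType) (n : nat) (f : 'I_n -> int -> R)
    (p : int) : R :=
  \sum_(k \in [set k : {ffun 'I_n -> int} | \sum_(j < n) k j = p])
    \prod_(j < n) f j (k j).

Definition g (R : realType) (n : nat) (m : 'I_n -> nat) (p : int) : R :=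
  convolution (fun j => chi R (m j)) p.

Definition mutually_independent (d : measure_display) (T : measurableType d)
    (R : realType) (P : probability T R) (n : nat)
    (X : 'I_n -> {RV P >-> R}) : Prop :=
  forall (J : {set 'I_n}) (A : 'I_n -> set R),
    (forall j, measurable (A j)) ->
    P [set w | forall j, j \in J -> A j (X j w)] =
    (\prod_(j in J) P (X j @^-1` A j))%E.

(* When f has total mass 1, this forces Y to be almost surely integer-valued. *)
Definition has_mass_function (d : measure_display) (T : measurableType d)
    (R : realType) (P : probability T R) (Y : T -> R) (f : int -> R) : Prop :=
  forall p : int, P [set w | Y w = p%:~R] = (f p)%:E.

(* [b k] is the coefficient of x ^ (2k - n), an integer power, in a series
   converging to (1 / sin x) ^ n on a punctured neighbourhood of 0; it is what
   is usually indexed by 2k. *)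
Definition laurent_inv_sin (R : realType) (n : nat) (b : nat -> R) : Prop :=
  \forall x \near (0 : R)^',
    (\sum_(0 <= k < N) x ^ ((2 * k)%N%:Z - n%:Z) * b k) @[N --> \oo]
      --> (1 / sin x) ^+ n.

(* A sign vector eps is encoded by e : {ffun 'I_n -> bool} as
   eps_j = (-1) ^+ e j; this is 2 p + \sum_j (2 m_j + 1) eps_j. *)
Definition signed_sum (n : nat) (m : 'I_n -> nat) (e : {ffun 'I_n -> bool})
    (p : int) : int :=
  2 * p + \sum_(j < n) (2 * m j + 1)%N%:Z * (-1) ^+ e j.

(* Main.v *)
(* Put T_n(s) for the residue at 0 of e^(s x) / sinh(x)^n, a polynomial in s
   whose coefficients are the (-1)^k b_(2k) up to factorials. Multiplying and
   differentiating the power series give T_(n+1)(s +- 1) = (s/n +- 1) T_n(s),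
   hence, for integers s = n mod 2,
     F_(n+1)(s+1) - F_(n+1)(s-1) = 2 F_n(s)  where  F_n(s) = sign(s) T_n(s),
   so n divided differences turn F_n into a Kronecker delta. The signed sum
   over eps is the operator prod_j (E^(2 m_j + 1) - 1) applied to F_n, with E
   the shift s -> s + 2, and X^a - 1 = (X - 1)(1 + ... + X^(a-1)) splits it into
   these n differences and the convolution of the indicators of the intervals.
   The explicit b_(2k) come from expanding (x / sinh x)^n in powers of
   1 - sinh(x)/x, truncating, and re-expanding in powers of sinh(x)/x. *)
Require Import Defs.
From HB Require Import structures.
From mathcomp Require Import all_boot all_order all_algebra.
From mathcomp Require Import all_classical all_reals all_analysis.
From mathcomp Require Import ring zify lra.
Import Order.TTheory GRing.Theory Num.Theory.
Import numFieldNormedType.Exports.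

Set Implicit Arguments.
Unset Strict Implicit.
Unset Printing Implicit Defensive.

Local Open Scope classical_set_scope.
Local Open Scope ring_scope.

(** * Formal power series *)

(** A name of its own keeps the Cauchy product of series apart from the pointwise product of
    functions. *)
Definition fps (K : comNzRingType) : Type := nat -> K.

HB.instance Definition _ (K : comNzRingType) := Choice.copy (fps K) (nat -> K).

Definition fps_zero (K : comNzRingType) : fps K := fun=> 0.
Definition fps_opp (K : comNzRingType) (a : fps K) : fps K := fun i => - a i.
Definition fps_add (K : comNzRingType) (a b : fps K) : fps K :=
  fun i => a i + b i.
Definition fps_one (K : comNzRingType) : fps K := fun i => (i == 0%N)%:R.
Definition fps_mul (K : comNzRingType) (a b : fps K) : fps K :=
  fun i => \sum_(j < i.+1) a j * b (i - j)%N.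

Lemma fps_addA (K : comNzRingType) : associative (@fps_add K).
Proof. by move=> a b c; apply/funext => i; rewrite /fps_add addrA. Qed.

Lemma fps_addC (K : comNzRingType) : commutative (@fps_add K).
Proof. by move=> a b; apply/funext => i; rewrite /fps_add addrC. Qed.

Lemma fps_add0 (K : comNzRingType) : left_id (@fps_zero K) (@fps_add K).
Proof. by move=> a; apply/funext => i; rewrite /fps_add add0r. Qed.

Lemma fps_addN (K : comNzRingType) :
  left_inverse (@fps_zero K) (@fps_opp K) (@fps_add K).
Proof. by move=> a; apply/funext => i; rewrite /fps_add addNr. Qed.

HB.instance Definition _ (K : comNzRingType) :=
  GRing.isZmodule.Build (fps K) (@fps_addA K) (@fps_addC K) (@fps_add0 K)
    (@fps_addN K).

Definition fps_trunc (K : comNzRingType) (N : nat) (a : fps K) : {poly K} :=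
  \poly_(i < N) a i.

Lemma coef_fps_trunc (K : comNzRingType) (N : nat) (a : fps K) i :
  (i < N)%N -> (fps_trunc N a)`_i = a i.
Proof. by move=> iN; rewrite coef_poly iN. Qed.

(** The coefficient of degree i of a product depends only on degrees up to i, so polynomials that
    agree that far may stand for the series. This carries identities from [{poly K}] over to
    series. *)
Lemma fps_mul_trunc (K : comNzRingType) (p q : {poly K}) (a b : fps K) i :
  (forall j, (j <= i)%N -> p`_j = a j) -> (forall j, (j <= i)%N -> q`_j = b j) ->
  (p * q)`_i = fps_mul a b i.
Proof.
move=> pa qb; rewrite coefM; apply: eq_bigr => j _.
by rewrite pa ?qb ?leq_subr// -ltnS.
Qed.

Lemma fps_mulA (K : comNzRingType) : associative (@fps_mul K).
Proof.
move=> a b c; apply/funext => i.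
pose t := @fps_trunc K i.+1.
have tE (d : fps K) j : (j <= i)%N -> (t d)`_j = d j.
  by move=> ji; rewrite coef_fps_trunc.
have tM (d e : fps K) j : (j <= i)%N -> (t d * t e)`_j = fps_mul d e j.
  by move=> ji; apply: fps_mul_trunc => k kj; rewrite tE// (leq_trans kj).
rewrite -(@fps_mul_trunc _ (t a) (t b * t c) a (fps_mul b c)); [|exact: tE|exact: tM].
rewrite -(@fps_mul_trunc _ (t a * t b) (t c) (fps_mul a b) c); [|exact: tM|exact: tE].
by rewrite mulrA.
Qed.

Lemma fps_mulC (K : comNzRingType) : commutative (@fps_mul K).
Proof.
move=> a b; apply/funext => i.
have tE (d : fps K) j : (j <= i)%N -> (fps_trunc i.+1 d)`_j = d j.
  by move=> ji; rewrite coef_fps_trunc.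
by rewrite -(fps_mul_trunc (tE a) (tE b)) -(fps_mul_trunc (tE b) (tE a)) mulrC.
Qed.

Lemma fps_mul1 (K : comNzRingType) : left_id (@fps_one K) (@fps_mul K).
Proof.
move=> a; apply/funext => i; rewrite /fps_mul big_ord_recl /fps_one/= mul1r subn0.
by rewrite big1 ?addr0// => j _; rewrite mul0r.
Qed.

Lemma fps_mulDl (K : comNzRingType) :
  left_distributive (@fps_mul K) (@fps_add K).
Proof.
move=> a b c; apply/funext => i; rewrite /fps_add /fps_mul -big_split/=.
by apply: eq_bigr => j _; rewrite mulrDl.
Qed.

Lemma fps_one_neq0 (K : comNzRingType) : @fps_one K != 0.
Proof.
apply/eqP => /(congr1 (fun a : fps K => a 0%N)) /= /eqP.
by rewrite /fps_one/= oner_eq0.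
Qed.

HB.instance Definition _ (K : comNzRingType) :=
  GRing.Zmodule_isComNzRing.Build (fps K) (@fps_mulA K) (@fps_mulC K)
    (@fps_mul1 K) (@fps_mulDl K) (@fps_one_neq0 K).

Lemma fpsD (K : comNzRingType) (a b : fps K) i : (a + b) i = a i + b i.
Proof. by []. Qed.

Lemma fpsN (K : comNzRingType) (a : fps K) i : (- a) i = - a i.
Proof. by []. Qed.

Lemma fps1 (K : comNzRingType) i : (1 : fps K) i = (i == 0%N)%:R.
Proof. by []. Qed.

Lemma fpsM (K : comNzRingType) (a b : fps K) i :
  (a * b) i = \sum_(j < i.+1) a j * b (i - j)%N.
Proof. by []. Qed.

Lemma fps_sum (K : comNzRingType) (I : Type) (r : seq I) (P : pred I)
    (F : I -> fps K) i :
  (\sum_(k <- r | P k) F k) i = \sum_(k <- r | P k) F k i.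
Proof. by elim/big_rec2: _ => // k x y _ <-. Qed.

Lemma fpsMn (K : comNzRingType) (a : fps K) k i : (a *+ k) i = a i *+ k.
Proof. by elim: k => // k IH; rewrite !mulrS fpsD IH. Qed.

Definition fpsC (K : comNzRingType) (c : K) : fps K :=
  fun i => if i == 0%N then c else 0.

Lemma fpsCM (K : comNzRingType) (c : K) (a : fps K) i :
  (fpsC c * a) i = c * a i.
Proof.
rewrite fpsM big_ord_recl/= subn0 big1 ?addr0// => j _.
by rewrite /fpsC/= mul0r.
Qed.

Definition fpsX (K : comNzRingType) : fps K := fun i => (i == 1%N)%:R.

Lemma fpsXM (K : comNzRingType) (a : fps K) i :
  (fpsX K * a) i = if i is i'.+1 then a i' else 0.
Proof.
case: i => [|i]; rewrite fpsM.
  by rewrite big_ord1 /fpsX mul0r.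
rewrite big_ord_recl big_ord_recl/= /fpsX/= mul0r add0r mul1r.
by rewrite big1 ?addr0 ?subSS ?subn0// => j _; rewrite mul0r.
Qed.

Lemma fpsXnM (K : comNzRingType) (a : fps K) k i :
  (fpsX K ^+ k * a) (k + i)%N = a i.
Proof. by elim: k => [|k IH]; rewrite ?mul1r// exprS -mulrA addSn fpsXM. Qed.

Definition fps_deriv (K : comNzRingType) (a : fps K) : fps K :=
  fun i => a i.+1 *+ i.+1.

Lemma fps_derivM (K : comNzRingType) (a b : fps K) :
  fps_deriv (a * b) = fps_deriv a * b + a * fps_deriv b.
Proof.
apply/funext => i.
(* One degree more than usual is kept, as degree i of a derivative uses degree i + 1. *)
pose t := @fps_trunc K i.+2.
have tE (d : fps K) j : (j <= i.+1)%N -> (t d)`_j = d j.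
  by move=> ji; rewrite coef_fps_trunc.
have tD (d : fps K) j : (j <= i)%N -> (t d)^`()`_j = fps_deriv d j.
  by move=> ji; rewrite coef_deriv tE.
rewrite fpsD -[(fps_deriv a * b) i](fps_mul_trunc (tD a) (fun j ji => tE b j (leqW ji))).
rewrite -[(a * fps_deriv b) i](fps_mul_trunc (fun j ji => tE a j (leqW ji)) (tD b)).
by rewrite -coefD -derivM coef_deriv (fps_mul_trunc (tE a) (tE b)).
Qed.

Lemma fps_derivX (K : comNzRingType) (a : fps K) k :
  fps_deriv (a ^+ k.+1) = fps_deriv a * a ^+ k *+ k.+1.
Proof.
elim: k => [|k IH]; first by rewrite expr0 mulr1 expr1.
rewrite exprS fps_derivM IH.
by rewrite mulrnAr mulrCA -exprS -mulrS.
Qed.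

Definition fps_exp (K : fieldType) (a : K) : fps K := fun i => a ^+ i / i`!%:R.

Lemma fps_expD (R : numFieldType) (a b : R) :
  fps_exp (a + b) = fps_exp a * fps_exp b.
Proof.
apply/funext => i; rewrite fpsM /fps_exp addrC exprDn mulr_suml.
apply: eq_bigr => j _; have ji : (j <= i)%N by rewrite -ltnS.
have f0 k : (k`!%:R : R) != 0 by rewrite pnatr_eq0 -lt0n fact_gt0.
have -> : i`!%:R = 'C(i, j)%:R * j`!%:R * (i - j)`!%:R :> R.
  by rewrite -!natrM -mulnA bin_fact.
rewrite -mulr_natr.
have b0 : ('C(i, j)%:R : R) != 0 by rewrite pnatr_eq0 -lt0n bin_gt0.
by field; rewrite !f0 b0.
Qed.

Lemma fps_exp0 (R : numFieldType) : fps_exp (0 : R) = 1.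
Proof.
apply/funext => -[|i]; first by rewrite /fps_exp expr0 fact0 divr1 fps1.
by rewrite /fps_exp expr0n mul0r fps1.
Qed.

Lemma fps_expX (R : numFieldType) (a : R) k : fps_exp a ^+ k = fps_exp (a *+ k).
Proof.
elim: k => [|k IH]; first by rewrite mulr0n fps_exp0.
by rewrite exprS IH -fps_expD mulrS.
Qed.

Lemma fps_deriv_exp (R : numFieldType) (a : R) :
  fps_deriv (fps_exp a) = fpsC a * fps_exp a.
Proof.
apply/funext => i; rewrite fpsCM /fps_deriv /fps_exp exprS factS natrM.
have f0 : (i`!%:R : R) != 0 by rewrite pnatr_eq0 -lt0n fact_gt0.
have i0 : (i.+1%:R : R) != 0 by rewrite pnatr_eq0.
rewrite -[LHS]mulr_natr; move: (i.+1%:R : R) i0 => c c0.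
by field; rewrite f0 c0.
Qed.

(** The series a(c x). *)
Definition fps_scale (K : comNzRingType) (c : K) (a : fps K) : fps K :=
  fun i => c ^+ i * a i.

Lemma fps_scaleM (K : comNzRingType) (c : K) (a b : fps K) :
  fps_scale c (a * b) = fps_scale c a * fps_scale c b.
Proof.
apply/funext => i; rewrite fpsM /fps_scale fpsM mulr_sumr.
apply: eq_bigr => j _; rewrite mulrACA -exprD subnKC//.
by rewrite -ltnS.
Qed.

Lemma fps_scale1 (K : comNzRingType) (c : K) : fps_scale c 1 = 1.
Proof.
by apply/funext => -[|i]; rewrite /fps_scale fps1 ?expr0 ?mul1r// mulr0.
Qed.

Lemma fps_scaleX (K : comNzRingType) (c : K) (a : fps K) k :
  fps_scale c (a ^+ k) = fps_scale c a ^+ k.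
Proof.
elim: k => [|k IH]; first exact: fps_scale1.
by rewrite !exprS fps_scaleM IH.
Qed.

(* The series [a(x ^ 2)]. *)
Definition fps_sq (K : comNzRingType) (a : fps K) : fps K :=
  fun i => if odd i then 0 else a i./2.

Lemma fps_sqM (K : comNzRingType) (a b : fps K) :
  fps_sq (a * b) = fps_sq a * fps_sq b.
Proof.
apply/funext => i; pose t := @fps_trunc K i.+1.
have tE (d : fps K) j : (j <= i)%N -> (t d)`_j = d j.
  by move=> ji; rewrite coef_fps_trunc.
have cE (p : {poly K}) j :
    (p \Po 'X^2)`_j = if odd j then 0 else p`_(j./2).
  by rewrite coef_comp_poly_Xn// dvdn2 divn2; case: odd.
have sE (d : fps K) j : (j <= i)%N -> (t d \Po 'X^2)`_j = fps_sq d j.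
  by move=> ji; rewrite cE tE//; lia.
rewrite -[RHS](fps_mul_trunc (sE a) (sE b)) -comp_polyM cE /fps_sq.
case: odd => //.
have hi : (i./2 <= i)%N by lia.
by rewrite -[LHS](fps_mul_trunc (fun j ji => tE a j (leq_trans ji hi))
  (fun j ji => tE b j (leq_trans ji hi))).
Qed.

Lemma fps_sq1 (K : comNzRingType) : fps_sq 1 = 1 :> fps K.
Proof.
by apply/funext => -[|[|i]]; rewrite /fps_sq//= !fps1; case: odd.
Qed.

Lemma fps_sqX (K : comNzRingType) (a : fps K) k :
  fps_sq (a ^+ k) = fps_sq a ^+ k.
Proof.
elim: k => [|k IH]; first exact: fps_sq1.
by rewrite !exprS fps_sqM IH.
Qed.

(** Each coefficient of 1/a is computed from all earlier ones, so the whole list is carried along.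
    The recursion is the one for constant term 1, where no division occurs. *)
Fixpoint fps_inv_seq (K : comNzRingType) (a : fps K) (k : nat) : seq K :=
  if k is k'.+1 then
    let s := fps_inv_seq a k' in
    rcons s (- \sum_(j < k'.+1) a j.+1 * s`_(k' - j))
  else [:: 1].

Definition fps_inv (K : comNzRingType) (a : fps K) : fps K :=
  fun k => (fps_inv_seq a k)`_k.

Lemma size_fps_inv_seq (K : comNzRingType) (a : fps K) k :
  size (fps_inv_seq a k) = k.+1.
Proof. by elim: k => //= k IH; rewrite size_rcons IH. Qed.

Lemma nth_fps_inv_seq (K : comNzRingType) (a : fps K) k i :
  (i <= k)%N -> (fps_inv_seq a k)`_i = fps_inv a i.
Proof.
elim: k => [|k IH]; first by rewrite leqn0 => /eqP->.
rewrite leq_eqVlt => /predU1P[->//|ik].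
by rewrite /= nth_rcons size_fps_inv_seq ik IH.
Qed.

Lemma fps_invS (K : comNzRingType) (a : fps K) k :
  fps_inv a k.+1 = - \sum_(j < k.+1) a j.+1 * fps_inv a (k - j)%N.
Proof.
rewrite {1}/fps_inv/= nth_rcons size_fps_inv_seq ltnn eqxx.
by congr (- _); apply: eq_bigr => j _; rewrite nth_fps_inv_seq// leq_subr.
Qed.

Lemma fps_mulV (K : comNzRingType) (a : fps K) : a 0%N = 1 -> a * fps_inv a = 1.
Proof.
move=> a0; apply/funext => -[|k]; rewrite fpsM.
  by rewrite big_ord1 a0 mul1r.
by rewrite big_ord_recl a0 mul1r subn0 fps_invS fps1/= addNr.
Qed.

(** * Residues of exp (s x) / sinh (x) ^ n *)

(* [sinh x / x = sinhc (x ^ 2)]. *)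
Definition sinhc (R : numFieldType) : fps R := fun k => ((2 * k).+1`!%:R)^-1.

Definition xsinhc (R : numFieldType) : fps R := fps_sq (sinhc R).
Definition inv_xsinhc (R : numFieldType) : fps R := fps_sq (fps_inv (sinhc R)).

Lemma xsinhcV (R : numFieldType) : xsinhc R * inv_xsinhc R = 1.
Proof.
rewrite /xsinhc /inv_xsinhc -fps_sqM fps_mulV ?fps_sq1//.
by rewrite /sinhc muln0 invr1.
Qed.

Lemma fpsX_xsinhc (R : numFieldType) :
  fpsX R * xsinhc R *+ 2 = fps_exp 1 - fps_exp (- 1).
Proof.
apply/funext => -[|i]; rewrite fpsMn fpsXM fpsD fpsN /fps_exp.
  by rewrite !expr0 subrr mul0rn.
rewrite /xsinhc /fps_sq /sinhc -signr_odd expr1n /=.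
case: (boolP (odd i)) => io /=; first by rewrite expr0 mul0rn subrr.
have -> : (2 * i./2).+1 = i.+1 by lia.
by rewrite expr1 mulN1r mul1r opprK.
Qed.

(* The residue at 0 of [exp (s x) / sinh (x) ^ n], for [0 < n]. *)
Definition sinh_res (R : numFieldType) (n : nat) (s : R) : R :=
  (inv_xsinhc R ^+ n * fps_exp s) n.-1.

(** The identity e^((s+1)x) - e^((s-1)x) = 2 e^(s x) sinh(x) cancels one factor sinh(x) of the
    denominator. *)
Lemma sinh_res_sub (R : numFieldType) n (s : R) :
  sinh_res n.+2 (s + 1) - sinh_res n.+2 (s - 1) = sinh_res n.+1 s *+ 2.
Proof.
rewrite /sinh_res/= !fps_expD -fpsN -fpsD -fpsMn.
rewrite (_ : _ - _ = fpsX R * (inv_xsinhc R ^+ n.+1 * fps_exp s *+ 2)).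
  by rewrite fpsXM.
rewrite -mulrBr -mulrBr -fpsX_xsinhc -[RHS]mulr1 -(xsinhcV R) exprS.
move: (xsinhc R) (inv_xsinhc R) (fpsX R) (fps_exp s) => a b c d; ring.
Qed.

(* The coefficient form of the vanishing residue of the derivative of
   [exp (s x) / sinh (x) ^ n]. *)
Lemma sinh_res_add (R : numFieldType) n (s : R) :
  (sinh_res n.+2 (s + 1) + sinh_res n.+2 (s - 1)) *+ n.+1 =
  s * sinh_res n.+1 s *+ 2.
Proof.
pose h := xsinhc R; pose H := inv_xsinhc R; pose E := fps_exp s.
have hH : h * H = 1 by exact: xsinhcV.
have D1 : fps_deriv (1 : fps R) = 0.
  by apply/funext => i; rewrite /fps_deriv fps1 mul0rn.
have HD : fps_deriv h * H + h * fps_deriv H = 0.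
  by rewrite -fps_derivM hH.
(* Differentiate x h(x) = sinh(x). *)
have cosh : fps_exp 1 + fps_exp (- 1) = (h + fpsX R * fps_deriv h) *+ 2.
  have DX : fps_deriv (fpsX R) = 1.
    by apply/funext => -[|i]; rewrite /fps_deriv /fpsX fps1//= mul0rn.
  have DMn (a : fps R) k : fps_deriv (a *+ k) = fps_deriv a *+ k.
    by apply/funext => i; rewrite fpsMn /fps_deriv fpsMn mulrnAC.
  have DB (a b : fps R) : fps_deriv (a - b) = fps_deriv a - fps_deriv b.
    by apply/funext => i; rewrite fpsD fpsN /fps_deriv fpsD fpsN mulrnBl.
  have := congr1 (@fps_deriv R) (fpsX_xsinhc R).
  rewrite DMn fps_derivM DX mul1r DB !fps_deriv_exp => ->.
  have -> : fpsC 1 = 1 :> fps R by apply/funext => -[].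
  have -> : fpsC (- 1) = - 1 :> fps R.
    by apply/funext => -[|i]; rewrite fpsN /fpsC fps1//= oppr0.
  by rewrite mul1r mulN1r opprK.
have DHE : fps_deriv (H ^+ n.+1 * E) =
    fps_deriv H * H ^+ n * E *+ n.+1 + fpsC s * (H ^+ n.+1 * E).
  rewrite fps_derivM fps_derivX fps_deriv_exp mulrnAl.
  by congr (_ + _); rewrite mulrCA.
(* In degree n + 1 the operator x d/dx multiplies by n + 1, so the first and last terms on the right
   cancel there and only the term with s survives. *)
have key : (H ^+ n.+2 * (E * (fps_exp 1 + fps_exp (- 1)))) *+ n.+1 =
    (H ^+ n.+1 * E *+ n.+1 +
     fpsC s * (fpsX R * (H ^+ n.+1 * E)) - fpsX R * fps_deriv (H ^+ n.+1 * E)) *+ 2.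
  rewrite cosh DHE.
  have -> : fps_deriv H = - (fps_deriv h * H ^+ 2).
    apply/eqP; rewrite -subr_eq0 opprK -[fps_deriv H]mul1r -hH.
    rewrite [X in X == _](_ : _ = H * (fps_deriv h * H + h * fps_deriv H)).
      by rewrite HD mulr0.
    by move: (fps_deriv h) (fps_deriv H) => a b; ring.
  have -> : H ^+ n.+1 * E *+ n.+1 = H ^+ n.+2 * (E * h) *+ n.+1.
    rewrite -[H ^+ n.+1 * E]mulr1 -[in LHS]hH [H ^+ n.+2]exprS.
    by congr (_ *+ _); ring.
  rewrite !exprS; move: (fps_deriv h) (fpsC s) (fpsX R) => h' c x.
  by ring.
rewrite /sinh_res/= !fps_expD -fpsD -fpsMn -mulrDr -mulrDr key.
rewrite fpsMn !fpsD fpsN fpsCM !fpsXM/= fpsMn /fps_deriv.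
by rewrite addrAC subrr add0r.
Qed.

Lemma sinh_resE (R : numFieldType) n (s : R) :
  sinh_res n.+2 (s + 1) = (s / n.+1%:R + 1) * sinh_res n.+1 s /\
  sinh_res n.+2 (s - 1) = (s / n.+1%:R - 1) * sinh_res n.+1 s.
Proof.
have := sinh_res_sub n s.
have : (sinh_res n.+2 (s + 1) + sinh_res n.+2 (s - 1)) * n.+1%:R =
    s * sinh_res n.+1 s *+ 2 by rewrite mulr_natr sinh_res_add.
have : (n.+1%:R : R) != 0 by rewrite pnatr_eq0.
move: (n.+1%:R : R) => c c0.
move: (sinh_res n.+2 (s + 1)) (sinh_res n.+2 (s - 1)) (sinh_res n.+1 s) => a b t add sub.
have {}add : a + b = s * t *+ 2 / c by rewrite -add mulfK.
have -> : a = (s * t *+ 2 / c + t *+ 2) / 2 by rewrite -add -sub; field.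
have -> : b = (s * t *+ 2 / c - t *+ 2) / 2 by rewrite -add -sub; field.
by split; field; rewrite c0.
Qed.

Lemma sinh_res1 (R : numFieldType) (s : R) : sinh_res 1 s = 1.
Proof.
by rewrite /sinh_res expr1 fpsM big_ord1/= /inv_xsinhc /fps_sq/= mul1r
  /fps_exp expr0 fact0 divr1.
Qed.

(** At s = 0 only an even series is left. This zero is what makes the value sign(0) = 0 harmless in
    [signed_res_sub]. *)
Lemma sinh_resS0 (R : numFieldType) n : odd n -> sinh_res n.+1 (0 : R) = 0.
Proof.
by move=> no; rewrite /sinh_res/= fps_exp0 mulr1 /inv_xsinhc -fps_sqX /fps_sq no.
Qed.

Lemma sinh_res_sum (R : numFieldType) n (s : R) : sinh_res n.+1 s =
  \sum_(0 <= k < (n %/ 2).+1)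
     (fps_inv (sinhc R) ^+ n.+1) k * (s ^+ (n - 2 * k) / ((n - 2 * k)`!)%:R).
Proof.
rewrite /sinh_res/= fpsM /inv_xsinhc -fps_sqX /fps_sq divn2.
rewrite -(big_mkord xpredT (fun i => (if odd i then 0 else
  (fps_inv (sinhc R) ^+ n.+1) i./2) * fps_exp s (n - i)%N)).
have odd_even N (F : nat -> R) :
    (forall i, odd i -> F i = 0) ->
    \sum_(0 <= i < N.+1) F i = \sum_(0 <= k < (N./2).+1) F (2 * k)%N.
  move=> F0; elim: N => [|N IH]; first by rewrite !big_nat1.
  rewrite big_nat_recr//= IH; case: (boolP (odd N)) => No.
    have -> : uphalf N = N./2.+1 by lia.
    by rewrite [RHS]big_nat_recr//=; congr (_ + F _); lia.
  have -> : uphalf N = N./2 by lia.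
  by rewrite F0 ?addr0//=.
rewrite odd_even => [|i ->]; last by rewrite mul0r.
apply: eq_bigr => k _; rewrite mul2n odd_double doubleK.
by rewrite /fps_exp.
Qed.

(** * Coefficients of negative powers of a series *)

Lemma fpsXnM_lt (K : comNzRingType) (a : fps K) k i :
  (i < k)%N -> (fpsX K ^+ k * a) i = 0.
Proof.
elim: k i => // k IH i; rewrite exprS -mulrA fpsXM.
by case: i => // i /IH.
Qed.

Lemma fps_coef_expM_lt (K : comNzRingType) (v a : fps K) k i :
  v 0%N = 0 -> (i < k)%N -> (v ^+ k * a) i = 0.
Proof.
move=> v0 ik; pose v' : fps K := fun j => v j.+1.
have -> : v = fpsX K * v'.
  by apply/funext => -[|j]; rewrite fpsXM.
by rewrite exprMn -mulrA fpsXnM_lt.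
Qed.

(** This is the expansion of (1 - v)^-(n+1) in v = 1 - h, with the tail kept as a multiple of v^N so
    that no infinite sum occurs. The case n = 0 is the geometric sum, and each further factor H is
    absorbed by Pascal's rule. *)
Lemma neg_binomial_series (A : comNzRingType) (h H : A) n N : h * H = 1 ->
  exists c, H ^+ n.+1 =
    \sum_(j < N) (1 - h) ^+ j *+ 'C(n + j, j) + (1 - h) ^+ N * c.
Proof.
move=> hH; set v := 1 - h.
have hv : h = 1 - v by rewrite /v; ring.
elim: n => [|n [c IH]].
  exists H; rewrite expr1 -[LHS]mul1r.
  under eq_bigr do rewrite add0n binn mulr1n.
  apply/eqP; rewrite -subr_eq -mulrBl; apply/eqP.
  rewrite -opprB subrX1 -mulNr opprB -hv mulrAC hH.
  by rewrite mul1r.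
(* Multiplying the new sum by 1 - v telescopes up to one boundary term in v^N. The factor [(0 < N)]
   removes it at N = 0, where [N.-1] is 0 and the binomial coefficient would be 1. *)
exists (H *+ 'C(n + N, N.-1) *+ (0 < N)%N + H * c).
have step : h * \sum_(j < N) v ^+ j *+ 'C(n.+1 + j, j) =
    \sum_(j < N) v ^+ j *+ 'C(n + j, j) - v ^+ N *+ 'C(n + N, N.-1) *+ (0 < N)%N.
  rewrite hv; clear c IH; elim: N => [|N IH].
    by rewrite !big_ord0 mulr0 mulr0n subr0.
  rewrite !big_ord_recr/= mulrDr IH mulr1n.
  have e : v ^+ N *+ 'C(n.+1 + N, N) =
      v ^+ N *+ 'C(n + N, N) + v ^+ N *+ 'C(n + N, N.-1) *+ (0 < N)%N.
    clear IH; case: N => [|N]; first by rewrite !bin0 mulr0n addr0.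
    by rewrite mulr1n -mulrnDr addSn binS.
  rewrite mulrBl mul1r {1}e addnS -addSn mulrnAr -exprS /=.
  by rewrite addrA addrACA addNr addr0.
have -> : \sum_(j < N) v ^+ j *+ 'C(n.+1 + j, j) =
   H * (h * \sum_(j < N) v ^+ j *+ 'C(n.+1 + j, j)).
  by rewrite mulrA [H * h]mulrC hH mul1r.
rewrite step exprS IH; move: (\sum_(_ < _) _) (v ^+ N) => S w.
by ring.
Qed.

(** Since 'C(n + j, j) 'C(j, m) = 'C(n + m, m) 'C(n + j, n + m), this is the hockey-stick
    identity. *)
Lemma sum_bin_bin n m N :
  (\sum_(j < N) 'C(n + j, j) * 'C(j, m) = 'C(n + m, m) * 'C(n + N, n.+1 + m))%N.
Proof.
elim: N => [|N IH]; first by rewrite big_ord0 (@bin_small (n + 0)) ?muln0//; lia.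
rewrite big_ord_recr/= IH addnS addSn binS mulnDr; congr addn.
case: (leqP m N) => mN; last first.
  by rewrite (@bin_small N)// muln0 (@bin_small (n + N)) ?muln0//; lia.
have f0 := fact_gt0.
apply/eqP; rewrite -(eqn_pmul2r (f0 n)) -(eqn_pmul2r (f0 m)).
rewrite -(eqn_pmul2r (f0 (N - m)%N)); apply/eqP.
have := @bin_fact (n + N) N ltac:(lia); rewrite addnK.
have := @bin_fact N m mN.
have := @bin_fact (n + m) m ltac:(lia); rewrite addnK.
have := @bin_fact (n + N) (n + m) ltac:(lia); rewrite subnDl.
move=> e1 e2 e3 e4.
transitivity (n + N)`!; [rewrite -e4 -e3|rewrite -e1 -e2]; ring.
Qed.

Lemma fps_signM (K : comNzRingType) (a : fps K) m i :
  ((-1) ^+ m * a) i = (-1) ^+ m * a i.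
Proof.
rewrite -(signr_odd _ m) -[in RHS](signr_odd _ m); case: odd; rewrite ?expr0 ?mul1r//.
by rewrite !expr1 !mulN1r.
Qed.

(** As 1 - h has no constant term, its powers beyond the N-th do not reach degree N. The others are
    expanded by the binomial theorem, and the sum over their exponents is [sum_bin_bin]. *)
Lemma inv_power_coef (K : comNzRingType) (h H : fps K) n N :
  h * H = 1 -> h 0%N = 1 ->
  (H ^+ n.+1) N =
  \sum_(m < N.+1) (-1) ^+ m * ('C(n + m, m) * 'C(n.+1 + N, n.+1 + m))%:R * (h ^+ m) N.
Proof.
move=> hH h0; have [c ->] := neg_binomial_series n N.+1 hH.
rewrite fpsD (fps_coef_expM_lt c) ?addr0//; last by rewrite fpsD fpsN fps1 h0 subrr.
rewrite fps_sum.
have expand (j : 'I_N.+1) : ((1 - h) ^+ j *+ 'C(n + j, j)) N =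
    \sum_(m < N.+1) (-1) ^+ m * ('C(n + j, j) * 'C(j, m))%:R * (h ^+ m) N.
  rewrite fpsMn exprDn fps_sum.
  rewrite (big_ord_widen N.+1 (fun m => ((1 : fps K) ^+ (j - m) * (- h) ^+ m *+ 'C(j, m)) N))//.
  rewrite -sumrMnl big_mkcond/=; apply: eq_bigr => m _.
  case: ltnP => [mj|jm]; last by rewrite (@bin_small j)// muln0 mulr0 mul0r.
  rewrite fpsMn expr1n mul1r (exprNn h) natrM.
  rewrite fps_signM.
  by ring.
under eq_bigr do rewrite expand.
rewrite exchange_big/=; apply: eq_bigr => m _.
by rewrite -mulr_suml -mulr_sumr -natr_sum sum_bin_bin addnS addSn.
Qed.

(** Expand (2 sinh(x))^m = (e^x - e^(-x))^m by the binomial theorem and read off degree N + m, the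
    shift coming from x^m. *)
Lemma xsinhc_power_coef (R : numFieldType) m N :
  (xsinhc R ^+ m) N = (2 ^+ m * (N + m)`!%:R)^-1 *
    \sum_(r < m.+1) (-1) ^+ r * 'C(m, r)%:R * (m%:R - 2 * r%:R) ^+ (N + m).
Proof.
have : (xsinhc R ^+ m) N * 2 ^+ m = ((fps_exp 1 - fps_exp (- 1) : fps R) ^+ m) (m + N)%N.
  by rewrite -natrX mulr_natr -fpsX_xsinhc exprMn_n exprMn fpsMn fpsXnM.
rewrite (exprDn (fps_exp 1)) fps_sum => e.
have two0 : (2 ^+ m : R) != 0 by rewrite expf_neq0// pnatr_eq0.
apply: (mulIf two0); rewrite e invfM [RHS]mulrC !mulrA divff// mul1r.
rewrite mulr_sumr; apply: eq_bigr => r _.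
have rm : (r <= m)%N by rewrite -ltnS.
rewrite fpsMn (exprNn (fps_exp _)) [_ * (_ * _ : fps R)]mulrCA !fps_expX -fps_expD.
rewrite fps_signM.
rewrite /fps_exp natrB// addnC mulNrn.
rewrite (_ : m%:R - r%:R - r%:R = m%:R - 2 * r%:R); last by ring.
rewrite -[LHS]mulr_natr.
by move: ((-1) ^+ r) ('C(m, r)%:R : R) (_ ^+ (N + m)) (_^-1) => a b c d; ring.
Qed.

(** * Iterated differences *)

(* The value at [n = 0] is the one that extends [signed_res_sub] to [n = 0]. *)
Definition signed_res (R : realFieldType) (n : nat) (s : int) : R :=
  if n is 0%N then (s == 0)%:R else Num.sg s%:~R * sinh_res n s%:~R.

Lemma signed_res_sub (R : realFieldType) n (s t : int) : s = n%:Z + 2 * t ->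
  signed_res R n.+1 (s + 1) - signed_res R n.+1 (s - 1) = signed_res R n s *+ 2.
Proof.
move=> st; rewrite /signed_res.
have sgp (z : int) : 0 < z -> Num.sg (z%:~R : R) = 1.
  by move=> z0; rewrite gtr0_sg// ltr0z.
have sgn (z : int) : z < 0 -> Num.sg (z%:~R : R) = - 1.
  by move=> z0; rewrite ltr0_sg// ltrz0.
case: n st => [|n] st.
  rewrite !sinh_res1 !mulr1.
  have [s0|[s0|s0]] : s < 0 \/ s = 0 \/ 0 < s by lia.
  - by rewrite !sgn; [|lia|lia]; rewrite lt_eqF// subrr mul0rn.
  - by rewrite s0 sgp// sgn// eqxx opprK.
  - by rewrite !sgp; [|lia|lia]; rewrite gt_eqF// subrr mul0rn.
have := sinh_resE n (s%:~R : R).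
rewrite -[1](_ : 1%:~R = 1 :> R)// -intrD -intrB => -[eD eB].
(* For |s| > 1 the three signs agree. At s = 0 the values at 1 and -1 are opposite, and so are their
   signs, which makes the difference 0. At s = 1 or -1 one neighbour is 0, where the polynomial
   vanishes by parity. *)
have [s2|[s1|[s0|[s1|s2]]]] : s < - 1 \/ s = - 1 \/ s = 0 \/ s = 1 \/ 1 < s by lia.
- by rewrite !sgn ?eD ?eB; try lia; ring.
- rewrite s1 addNr in eD eB *.
  rewrite sinh_resS0 in eD; last by lia.
  rewrite sgr0 mul0r !sgn// eB sub0r !mulN1r opprK.
  move: (sinh_res _ _) eD => T eD; apply: subr0_eq; rewrite [RHS]eD.
  by ring.
- by rewrite s0 add0r sub0r in eD eB *; rewrite sgp// sgn// sgr0 eD eB mul0r; ring.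
- rewrite s1 subrr in eD eB *.
  rewrite sinh_resS0 in eB; last by lia.
  rewrite sgr0 mul0r !sgp// eD subr0 !mul1r.
  move: (sinh_res _ _) eB => T eB; apply: subr0_eq; rewrite [RHS]eB.
  by ring.
- by rewrite !sgp ?eD ?eB; try lia; ring.
Qed.

(** The linear functional sending X^i to G(i). With X read as the shift, it is the value at 0 of the
    difference operator q applied to G. *)
Definition poly_pairing (R : comNzRingType) (G : nat -> R) (q : {poly R}) : R :=
  \sum_(i < size q) q`_i * G i.

Lemma poly_pairingE (R : comNzRingType) (G : nat -> R) (q : {poly R}) N :
  (size q <= N)%N -> poly_pairing G q = \sum_(i < N) q`_i * G i.
Proof.
move=> qN; rewrite /poly_pairing (big_ord_widen N (fun i => q`_i * G i))//.
rewrite big_mkcond/=; apply: eq_bigr => i _; case: ltnP => // ?.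
by rewrite nth_default// mul0r.
Qed.

Lemma poly_pairingD (R : comNzRingType) (G : nat -> R) (p q : {poly R}) :
  poly_pairing G (p + q) = poly_pairing G p + poly_pairing G q.
Proof.
pose N := maxn (size p) (size q).
have pqN : (size (p + q)%R <= N)%N by exact: size_polyD.
rewrite !(@poly_pairingE _ _ _ N) ?leq_maxl ?leq_maxr//.
by rewrite -big_split; apply: eq_bigr => i _; rewrite coefD mulrDl.
Qed.

Lemma poly_pairing_sum (R : comNzRingType) (G : nat -> R) (I : finType)
    (q : I -> {poly R}) :
  poly_pairing G (\sum_k q k) = \sum_k poly_pairing G (q k).
Proof.
elim/big_rec2: _ => [|k x y _ <-]; last by rewrite poly_pairingD.
by rewrite /poly_pairing size_poly0 big_ord0.
Qed.

Lemma poly_pairing_ZXn (R : comNzRingType) (G : nat -> R) c k :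
  poly_pairing G (c *: 'X^k) = c * G k.
Proof.
rewrite (@poly_pairingE _ _ _ k.+1); last first.
  by rewrite (leq_trans (size_scale_leq _ _))// size_polyXn.
rewrite big_ord_recr/= coefZ coefXn eqxx mulr1 big1 ?add0r// => i _.
by rewrite coefZ coefXn ltn_eqF// mulr0 mul0r.
Qed.

(** Multiplication by X - 1 is adjoint to the forward difference, by summation by parts. *)
Lemma poly_pairing_XB1 (R : comNzRingType) (G : nat -> R) (q : {poly R}) :
  poly_pairing G (('X - 1) * q) = poly_pairing (fun i => G i.+1 - G i) q.
Proof.
pose N := (size q).+1.
have qN : (size q <= N)%N by rewrite leqnSn.
rewrite (@poly_pairingE _ _ _ N.+1); last first.
  by rewrite mulrBl mul1r (leq_trans (size_polyD _ _))// size_polyN geq_max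
    (leq_trans (size_polyMleq _ _)) ?size_polyX//= (leq_trans qN).
rewrite (@poly_pairingE _ _ _ N)//.
have coefE i : (('X - 1) * q)`_i = (if i is j.+1 then q`_j else 0) - q`_i.
  by rewrite mulrBl mul1r coefB coefXM; case: i.
under eq_bigr do rewrite coefE mulrBl.
rewrite big_split/= big_ord_recl/= mul0r add0r.
under [RHS]eq_bigr do rewrite mulrBr.
rewrite [RHS]big_split/= sumrN sumrN; congr (_ - _).
by rewrite big_ord_recr/= [q`_N]nth_default// mul0r addr0.
Qed.

(** Each of the n differences lowers the index of [signed_res] by one at the cost of a factor 2,
    down to the Kronecker delta. The offset n + 2t keeps the arguments in the parity class where
    [signed_res_sub] applies. *)
Lemma poly_pairing_XB1n (R : realFieldType) (n : nat) (t : int) (q : {poly R}) :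
  poly_pairing (fun i => signed_res R n (2 * i%:Z + (n%:Z + 2 * t)))
    (('X - 1) ^+ n * q) =
  2 ^+ n * poly_pairing (fun i => (i%:Z + (n%:Z + t) == 0)%:R) q.
Proof.
have pE G G' (r : {poly R}) : (forall i, G i = G' i) -> poly_pairing G r = poly_pairing G' r.
  by move=> e; apply: eq_bigr => i _; rewrite e.
elim: n t q => [|n IH] t q.
  rewrite !expr0 !mul1r; apply: pE => i; rewrite /signed_res !add0r -mulrDr.
  by rewrite mulf_eq0.
rewrite exprS -mulrA poly_pairing_XB1.
have pZ G (r : {poly R}) c : poly_pairing (fun i => G i *+ c) r = poly_pairing G r *+ c.
  by rewrite /poly_pairing -sumrMnl; apply: eq_bigr => i _; rewrite mulrnAr.
(* The difference is centred one unit above its lower argument, and (n + 1 + 2t) + 1 = n + 2(t +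
   1). *)
rewrite (pE _ (fun i => signed_res R n (2 * i%:Z + (n%:Z + 2 * (t + 1))) *+ 2)); last first.
  move=> i; rewrite -(@signed_res_sub _ _ _ (i%:Z + t + 1)); last by lia.
  by congr (signed_res _ _ _ - signed_res _ _ _); lia.
rewrite pZ IH exprS -mulrA [RHS]mulr_natl; congr (_ * _ *+ 2).
by apply: pE => i; congr (_ == _)%:R; lia.
Qed.

(** The product of the X^(2 m_j + 1) - 1 is taken in two ways: expanded, it gives one monomial per
    sign vector; factored, it is (X - 1)^n times the geometric sums. *)
Lemma sum_signs_signed_res (R : realFieldType) (n : nat) (m : 'I_n -> nat) (p : int) :
  \sum_(e : {ffun 'I_n -> bool}) (\prod_(j < n) (-1) ^+ e j) *
     signed_res R n (2 * p + \sum_(j < n) (2 * m j + 1)%N%:Z * (-1) ^+ e j) =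
  2 ^+ n * poly_pairing (fun i => (i%:Z + p == \sum_(j < n) (m j)%:Z)%:R)
     (\prod_(j < n) \sum_(k < 2 * m j + 1) 'X^k : {poly R}).
Proof.
pose q : {poly R} := \prod_(j < n) \sum_(k < 2 * m j + 1) 'X^k.
(* Chosen so that n + 2t is the signed sum with all signs -1, which belongs to the monomial X^0. *)
pose t : int := p - \sum_(j < n) (m j)%:Z - n%:Z.
have -> : poly_pairing (fun i => (i%:Z + p == \sum_(j < n) (m j)%:Z)%:R) q =
   poly_pairing (fun i => (i%:Z + (n%:Z + t) == 0)%:R) q.
  apply: eq_bigr => i _; congr (_ * (nat_of_bool _)%:R).
  by rewrite /t; move: (i : nat) (\sum_(j < n) (m j)%:Z) => k S; apply/eqP/eqP => ?; lia.
rewrite -poly_pairing_XB1n.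
have -> : ('X - 1) ^+ n * q = \sum_(e : {ffun 'I_n -> bool})
   (\prod_(j < n) (-1) ^+ e j) *: 'X^(\sum_(j < n | ~~ e j) (2 * m j + 1)).
  have -> : ('X - 1 : {poly R}) ^+ n = \prod_(j < n) ('X - 1).
    by rewrite prodr_const card_ord.
  rewrite -big_split/=.
  under eq_bigr do rewrite -subrX1.
  transitivity (\prod_(j < n) \sum_(b : bool)
      (-1) ^+ b *: (if b then 1 else 'X^(2 * m j + 1)) : {poly R}).
    apply: eq_bigr => j _; rewrite big_bool/= expr1 scaleN1r expr0 scale1r addrC.
    by [].
  rewrite bigA_distr_bigA/=; apply: eq_bigr => e _.
  rewrite scaler_prod; congr (_ *: _).
  rewrite (big_morph (fun k => 'X^k : {poly R}) (exprD _) (expr0 _)).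
  by rewrite [RHS]big_mkcond; apply: eq_bigr => j _; case: (e j).
rewrite poly_pairing_sum; apply: eq_bigr => e _; rewrite poly_pairing_ZXn.
congr (_ * signed_res _ _ _).
have -> : \sum_(j < n) (2 * m j + 1)%N%:Z * (-1) ^+ e j =
    2 * (\sum_(j < n | ~~ e j) (2 * m j + 1))%N%:Z - \sum_(j < n) (2 * m j + 1)%N%:Z.
  rewrite (big_morph Posz PoszD (erefl _)) mulr_sumr [in RHS]big_mkcond/=.
  rewrite -sumrB; apply: eq_bigr => j _.
  by case: (e j) => /=; lia.
have -> : \sum_(j < n) (2 * m j + 1)%N%:Z = 2 * (\sum_(j < n) (m j)%:Z) + n%:Z.
  under eq_bigr do rewrite PoszD PoszM.
  by rewrite big_split/= -mulr_sumr sumr_const card_ord; congr (_ + _); exact: natz.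
by rewrite /t; move: (\sum_(j < n) (m j)%:Z) => S; ring.
Qed.

(** * The mass function of the sum *)

Lemma chi_neq0 (R : realType) (m : nat) (k : int) :
  chi R m k != 0 -> exists2 i : nat, (i <= 2 * m)%N & k = m%:Z - i%:Z.
Proof.
rewrite /chi; case: ifP => [km _|]; last by rewrite eqxx.
by exists (absz (m%:Z - k)); lia.
Qed.

Lemma sum_chi (R : realType) (V : lmodType R) (m N : nat) (F : nat -> V) :
  (2 * m <= N)%N ->
  \sum_(k < N.+1) chi R m (m%:Z - k%:Z) *: F k =
  ((2 * m + 1)%N%:R)^-1 *: \sum_(k < 2 * m + 1) F k.
Proof.
move=> mN; rewrite scaler_sumr.
rewrite (big_ord_widen N.+1 (fun k => ((2 * m + 1)%N%:R)^-1 *: F k)); last first.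
  by rewrite addn1 ltnS.
rewrite [RHS]big_mkcond; apply: eq_bigr => k _; rewrite /chi.
case: ltnP => kj; first by rewrite ifT//; lia.
by rewrite ifF ?scale0r//; lia.
Qed.

(** Nonzero terms have k_j = m_j - f_j with f_j between 0 and 2 m_j. A common bound N makes the
    index type finite, and the extra values of f_j contribute 0. *)
Lemma g_ffun (R : realType) (n N : nat) (m : 'I_n -> nat) (p : int) :
  (forall j, 2 * m j <= N)%N ->
  g R m p =
  \sum_(f : {ffun 'I_n -> 'I_N.+1} | \sum_(j < n) ((m j)%:Z - (f j)%:Z) == p)
     \prod_(j < n) chi R (m j) ((m j)%:Z - (f j)%:Z).
Proof.
move=> mN; rewrite /g /convolution.
pose kf (f : {ffun 'I_n -> 'I_N.+1}) : {ffun 'I_n -> int} :=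
  [ffun j => (m j)%:Z - (f j)%:Z].
have kfE f j : kf f j = (m j)%:Z - (f j)%:Z by rewrite ffunE.
have kf_inj : injective kf.
  move=> f f' /ffunP ff'; apply/ffunP => j; apply/val_inj.
  by have := ff' j; rewrite !kfE => /addrI/oppr_inj[].
pose r := [seq kf f | f <- enum {: {ffun 'I_n -> 'I_N.+1}} & \sum_(j < n) kf f j == p].
rewrite (fsbigE r).
- rewrite big_map big_filter_cond big_enum_cond/=.
  apply: eq_big => [f|f _]; last by apply: eq_bigr => j _; rewrite kfE.
  under eq_bigr do rewrite kfE.
  case: eqP => [e|//]; rewrite /= mem_set//=.
  by under eq_bigr do rewrite kfE.
- by rewrite map_inj_uniq// filter_uniq// enum_uniq.
- by move=> k /= /mapP[f]; rewrite mem_filter => /andP[/eqP e _] ->.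
- move=> k/= kp kr; apply/eqP; apply: contraNT kr => /prodf_neq0 k0.
  have kj j : exists i : 'I_N.+1, k j = (m j)%:Z - (i : nat)%:Z.
    have [i im ->] := chi_neq0 (k0 j isT).
    by exists (inord i); rewrite inordK// ltnS (leq_trans im).
  pose f := [ffun j => projT1 (cid (kj j))].
  have kE : k = kf f by apply/ffunP => j; rewrite kfE ffunE; case: cid.
  apply/mapP; exists f => //; rewrite mem_filter mem_enum andbT.
  by rewrite -kE kp.
Qed.

(** The product is the generating function of the sum of the m_j - k_j, so its coefficient of X^i
    counts the tuples k whose sum is p, for i + p equal to the sum of the m_j. *)
Lemma g_pairing (R : realType) (n : nat) (m : 'I_n -> nat) (p : int) :
  g R m p = (\prod_(j < n) ((2 * m j + 1)%N%:R)^-1) *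
    poly_pairing (fun i => (i%:Z + p == \sum_(j < n) (m j)%:Z)%:R)
      (\prod_(j < n) \sum_(k < 2 * m j + 1) 'X^k : {poly R}).
Proof.
pose N := (\sum_(j < n) 2 * m j)%N.
have mN j : (2 * m j <= N)%N by rewrite /N (bigD1 j)//= leq_addr.
rewrite (g_ffun R p mN).
have poly_pairingZ G c (q : {poly R}) : c * poly_pairing G q = poly_pairing G (c *: q).
  rewrite (poly_pairingE _ (size_scale_leq c q)) /poly_pairing mulr_sumr.
  by apply: eq_bigr => i _; rewrite coefZ mulrA.
rewrite poly_pairingZ -scaler_prod.
have -> : \prod_(j < n) (((2 * m j + 1)%N%:R)^-1 *: \sum_(k < 2 * m j + 1) 'X^k) =
   \prod_(j < n) \sum_(k < N.+1) chi R (m j) ((m j)%:Z - k%:Z) *: 'X^k :> {poly R}.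
  by apply: eq_bigr => j _; rewrite (sum_chi (fun k => 'X^k : {poly R}) (mN j)).
rewrite bigA_distr_bigA/= poly_pairing_sum big_mkcond; apply: eq_bigr => f _.
rewrite scaler_prod -(big_morph (fun k => 'X^k : {poly R}) (exprD _) (expr0 _)).
rewrite poly_pairing_ZXn sumrB -!(big_morph Posz PoszD (erefl (Posz 0))).
rewrite [X in (nat_of_bool X)%:R](_ : _ = ((\sum_(j < n) m j)%N%:Z - (\sum_(j < n) f j)%N%:Z == p)).
   by case: eqP => _; rewrite ?mulr1 ?mulr0.
by rewrite subr_eq eq_sym addrC.
Qed.

Lemma g_sinh_res (R : realType) (n : nat) (m : 'I_n -> nat) (p : int) : (0 < n)%N ->
  g R m p = (\prod_(j < n) ((2 * m j + 1)%N%:R)^-1) / 2 ^+ n *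
    \sum_(e : {ffun 'I_n -> bool}) Num.sg ((signed_sum m e p)%:~R) *
       (\prod_(j < n) (-1) ^+ e j) * sinh_res n (signed_sum m e p)%:~R.
Proof.
move=> n_gt0; rewrite g_pairing -mulrA; congr (_ * _).
apply: (canRL (mulKf _)); first by rewrite expf_neq0 ?pnatr_eq0.
rewrite -sum_signs_signed_res; apply: eq_bigr => e _.
by case: n n_gt0 m e => // n _ m e; rewrite /signed_res mulrCA mulrA.
Qed.

(** The disjoint events [E f] have total mass 1. Those inside S and those inside its complement
    bound both probabilities from below, and as the bounds add up to 1 they are equalities. *)
Lemma has_mass_function_sum (R : realType) (n : nat) (m : 'I_n -> nat)
    (d : measure_display) (T : measurableType d) (P : probability T R)
    (X : 'I_n -> {RV P >-> R}) :
  mutually_independent X -> (forall j, has_mass_function P (X j) (chi R (m j))) ->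
  has_mass_function P (fun w => \sum_(j < n) X j w) (g R m).
Proof.
move=> indX massX p.
pose N := (\sum_(j < n) 2 * m j)%N.
have mN j : (2 * m j <= N)%N by rewrite /N (bigD1 j)//= leq_addr.
pose F := {ffun 'I_n -> 'I_N.+1}.
pose k (f : F) j : int := (m j)%:Z - (f j)%:Z.
pose E (f : F) := [set w | forall j, X j w = (k f j)%:~R].
pose u (f : F) := \prod_(j < n) chi R (m j) (k f j).
have PE f : P (E f) = (u f)%:E.
  have := indX [set: 'I_n]%SET (fun j => [set (k f j)%:~R]) (fun j => measurable_set1 _).
  rewrite (_ : [set w | _] = E f); last first.
    apply/seteqP; split => w /= Ew j; first by apply: Ew; rewrite inE.
    by move=> _; exact: Ew.
  move=> ->; rewrite /u (big_morph EFin EFinM (erefl 1%:E)).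
  by apply: eq_big => [j|j _]; [rewrite inE|exact: massX].
have mE f : measurable (E f).
  rewrite (_ : E f = \bigcap_(j in [set: 'I_n]) (X j @^-1` [set (k f j)%:~R])).
    by apply: fin_bigcap_measurable => // j _; exact: measurable_funPTI.
  by apply/seteqP; split => [w Ew j _|w Ew j]; exact: Ew.
have tE (Q : pred F) : trivIset [set` Q] E.
  move=> f f' _ _ [w [Ef Ef']]; apply/ffunP => j; apply/val_inj.
  have := Ef j; rewrite Ef' => /intr_inj; rewrite /k.
  by move=> /addrI/oppr_inj[].
have PU (Q : pred F) : P (\bigcup_(f in [set` Q]) E f) = (\sum_(f | Q f) u f)%:E.
  rewrite measure_fin_bigcup; [|exact: finite_finset|exact: tE|by []].
  rewrite (fsbigE (enum Q)) ?enum_uniq//.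
  - rewrite -sumEFin big_enum_cond/=; apply: eq_big => [f|f _]; last exact: PE.
    by apply/andP/idP => [[]//|Qf]; split => //; exact: mem_set.
  - by move=> f /=; rewrite mem_enum.
  - by move=> f /= Qf; rewrite mem_enum => /negP; case.
have mS : measurable [set w | \sum_(j < n) X j w = p%:~R].
  rewrite -[[set w | _]]setTI.
  have mX : measurable_fun setT (fun w => \sum_(j < n) X j w) by exact: measurable_sum.
  exact: (mX measurableT [set p%:~R] (measurable_set1 _)).
have uT : \sum_f u f = 1.
  rewrite /u -(bigA_distr_bigA (fun j (i : 'I_N.+1) => chi R (m j) ((m j)%:Z - i%:Z))).
  rewrite big1// => j _.
  transitivity (\sum_(k < N.+1) chi R (m j) ((m j)%:Z - k%:Z) *: (1 : R^o)).
    by apply: eq_bigr => i _; rewrite [RHS]mulr1.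
  by rewrite (sum_chi (fun=> 1 : R^o) (mN j)) sumr_const card_ord [LHS]mulVf//.
pose Q (f : F) := \sum_(j < n) k f j == p.
rewrite (g_ffun R p mN) -/F.
have sumk (f : F) w : E f w -> \sum_(j < n) X j w = (\sum_(j < n) k f j)%:~R.
  by move=> Ef; rewrite rmorph_sum; apply: eq_bigr => j _; exact: Ef.
set S := [set w | _].
have le1 : ((\sum_(f | Q f) u f)%:E <= P S)%E.
  rewrite -PU; apply: le_measure; rewrite ?inE//.
    by apply: fin_bigcup_measurable.
  by move=> w [f /= Qf Ef]; rewrite /S/= (sumk _ _ Ef) (eqP Qf).
have le2 : ((\sum_(f | ~~ Q f) u f)%:E <= P (~` S))%E.
  rewrite -(PU (predC Q)); apply: le_measure; rewrite ?inE//.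
  - by apply: fin_bigcup_measurable.
  - exact: measurableC.
  move=> w [f /= Qf Ef]; rewrite /S/= (sumk _ _ Ef) => /intr_inj e.
  by case/negP: Qf; apply/eqP; exact: e.
rewrite probability_setC// in le2.
have PS : P S \is a fin_num by exact: fin_num_measure.
move: le1 le2; rewrite -(fineK PS) -EFinB !lee_fin => le1 le2.
congr EFin; apply/eqP; rewrite eq_le le1 andbT.
rewrite -lerN2 -(lerD2l 1) (le_trans _ le2)//.
by rewrite -[X in X - _]uT (bigID Q)/= [X in X - _]addrC addrK.
Qed.

(** * The Laurent series of 1 / sin (x) ^ n *)

Definition fps_sums (R : realType) (a : fps R) (y l : R) : Prop :=
  (\sum_(0 <= k < N) a k * y ^+ k) @[N --> \oo] --> l.

Definition geometric_bound (R : realType) (A r : R) (a : fps R) : Prop :=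
  forall k, `|a k| <= A * r ^+ k.

Lemma geometric_bound_ge0 (R : realType) (A r : R) (a : fps R) :
  geometric_bound A r a -> 0 <= A.
Proof. by move=> /(_ 0%N); rewrite expr0 mulr1; apply: le_trans. Qed.

Lemma ler_natS_exp2 (R : realType) k : (k.+1%:R : R) <= 2 ^+ k.
Proof. by rewrite -natrX ler_nat; exact: ltn_expl. Qed.

(** Each of the k + 1 terms is at most A B r^k, and k + 1 <= 2^k is absorbed by doubling the
    ratio. *)
Lemma coefM_geometric_bound (R : realType) (A B r : R) (a b : nat -> R) k :
  0 <= r -> (forall i, `|a i| <= A * r ^+ i) -> (forall i, `|b i| <= B * r ^+ i) ->
  `|\sum_(j < k.+1) a j * b (k - j)%N| <= A * B * (2 * r) ^+ k.
Proof.
move=> r0 ha hb; have A0 := geometric_bound_ge0 ha; have B0 := geometric_bound_ge0 hb.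
apply: le_trans (ler_norm_sum _ _ _) _.
apply: (@le_trans _ _ (\sum_(j < k.+1) A * B * r ^+ k)).
  apply: ler_sum => j _; have jk : (j <= k)%N by rewrite -ltnS.
  rewrite normrM (_ : r ^+ k = r ^+ j * r ^+ (k - j)); last by rewrite -exprD subnKC.
  rewrite mulrACA.
  by apply: ler_pM.
rewrite sumr_const card_ord -[leLHS]mulr_natr exprMn mulrA mulrAC.
rewrite ler_wpM2r ?exprn_ge0// ler_wpM2l ?mulr_ge0//.
exact: ler_natS_exp2.
Qed.

Lemma geometric_boundM (R : realType) (A B r : R) (a b : fps R) :
  0 <= r -> geometric_bound A r a -> geometric_bound B r b ->
  geometric_bound (A * B) (2 * r) (a * b).
Proof. by move=> r0 ha hb k; rewrite fpsM; exact: coefM_geometric_bound. Qed.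

Lemma geometric_bound_le (R : realType) (A r r' : R) (a : fps R) :
  0 <= r <= r' -> geometric_bound A r a -> geometric_bound A r' a.
Proof.
move=> /andP[r0 rr'] ha k; apply: le_trans (ha k) _.
by rewrite ler_wpM2l ?(geometric_bound_ge0 ha)// lerXn2r// ?nnegrE// (le_trans r0).
Qed.

(** The product of the N-th partial sums differs from the N-th partial sum of the product only in
    degrees N to 2N - 1. These are N terms of size at most A B (2 r |y|)^N, and N <= 2^N accounts
    for the constant 4. *)
Lemma fps_sumsM (R : realType) (A B r : R) (a b : fps R) (y l l' : R) :
  0 <= r -> geometric_bound A r a -> geometric_bound B r b ->
  4 * r * `|y| < 1 ->
  fps_sums a y l -> fps_sums b y l' -> fps_sums (a * b) y (l * l').
Proof.
move=> r0 ha hb ry sa sb.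
have A0 := geometric_bound_ge0 ha; have B0 := geometric_bound_ge0 hb.
pose t := 2 * r * `|y|.
have t0 : 0 <= t by rewrite !mulr_ge0.
have t1 : 2 * t < 1 by apply: le_lt_trans ry; rewrite /t; lra.
pose u (c : fps R) N := \sum_(0 <= k < N) c k * y ^+ k.
have uE c N : u c N = (fps_trunc N c).[y].
  rewrite (horner_coef_wide _ (size_poly _ _)) /u big_mkord.
  by apply: eq_bigr => i _; rewrite coef_fps_trunc.
pose e N := u a N * u b N - u (a * b) N.
have eE N : `|e N| <= A * B * (2 * t) ^+ N.
  pose p := fps_trunc N a * fps_trunc N b.
  have -> : e N = \sum_(N <= k < N + N) p`_k * y ^+ k.
    apply/eqP; rewrite subr_eq; apply/eqP.
    rewrite [u a N]uE [u b N]uE -hornerM -/p (@horner_coef_wide _ (N + N)); last first.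
      rewrite (leq_trans (size_polyMleq _ _))// (leq_trans (leq_pred _))//.
      by rewrite leq_add// size_poly.
    rewrite -(big_mkord xpredT (fun k => p`_k * y ^+ k)).
    rewrite (big_cat_nat (leq0n N) (leq_addr N N))/= addrC; congr (_ + _).
    rewrite /u; apply: eq_big_nat => k /andP[_ kN]; congr (_ * _).
    apply: fps_mul_trunc => j jk; rewrite coef_fps_trunc//;
      exact: leq_ltn_trans kN.
  apply: le_trans (ler_norm_sum _ _ _) _.
  apply: (@le_trans _ _ (\sum_(N <= k < N + N) A * B * t ^+ N)).
    rewrite big_nat_cond [leRHS]big_nat_cond; apply: ler_sum => k /andP[/andP[Nk _] _].
    have tb (c : fps R) C : geometric_bound C r c -> forall i, `|(fps_trunc N c)`_i| <= C * r ^+ i.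
      move=> hc i; rewrite coef_poly; case: ifP => // _; rewrite normr0.
      by rewrite mulr_ge0 ?exprn_ge0// (geometric_bound_ge0 hc).
    rewrite normrM coefM normrX.
    apply: (@le_trans _ _ (A * B * (2 * r) ^+ k * `|y| ^+ k)).
      by rewrite ler_wpM2r ?exprn_ge0//; apply: coefM_geometric_bound => //; exact: tb.
    rewrite -mulrA -exprMn -/t ler_wpM2l ?mulr_ge0//.
    by rewrite ler_wiXn2l//; lra.
  rewrite sumr_const_nat addnK -[leLHS]mulr_natr -mulrA ler_wpM2l ?mulr_ge0//.
  rewrite [(2 * t) ^+ N]exprMn mulrC ler_wpM2r ?exprn_ge0//.
  by apply: le_trans (ler_natS_exp2 R N); rewrite ler_nat.
have e0 : e N @[N --> \oo] --> 0.
  apply/norm_cvg0P; apply: (@squeeze_cvgr _ _ _ _ (cst 0) (fun N => A * B * (2 * t) ^+ N)).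
  - by near=> N; rewrite normr_ge0 eE.
  - exact: cvg_cst.
  - rewrite -[X in _ --> X](mulr0 (A * B)); apply: cvgMl_tmp; apply: cvg_expr.
    by rewrite ger0_norm ?mulr_ge0.
rewrite /fps_sums -[l * l']subr0 (_ : (fun N => _) = (fun N => u a N * u b N - e N)).
  by apply: cvgB => //; apply: cvgM.
by apply/funext => N; rewrite /e opprB addrC subrK.
Unshelve. all: by end_near.
Qed.

Lemma fps_sums1 (R : realType) (y : R) : fps_sums 1 y 1.
Proof.
rewrite /fps_sums -cvg_shiftS/= (_ : (fun N => _) = cst 1); first exact: cvg_cst.
apply/funext => N; rewrite big_nat_recl// expr0 mulr1 fps1 big1 ?addr0// => k _.
by rewrite fps1 mul0r.
Qed.

(** The growth bound is carried along to make this stable under products. *)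
Definition sums_sq_near0 (R : realType) (a : fps R) (f : R -> R) : Prop :=
  (exists A r, 0 <= r /\ geometric_bound A r a) /\
  \forall x \near (0 : R)^', fps_sums a (x ^+ 2) (f x).

Lemma dnbhs0_sqr_lt (R : realType) (c : R) :
  \forall x \near (0 : R)^', c * `|x ^+ 2| < 1.
Proof.
pose e := (1 + `|c|)^-1; have e0 : 0 < e by rewrite invr_gt0 ltr_pwDl.
have e1 : e <= 1 by rewrite invf_le1 ?ltr_pwDl// lerDl.
near=> x; have xe : `|x| < e by near: x; exact: dnbhs0_lt.
apply: (@le_lt_trans _ _ (`|c| * `|x|)).
  rewrite (le_trans (ler_wpM2r _ (ler_norm c)))// ler_wpM2l// normrX expr2.
  by rewrite ler_piMl// ltW// (lt_le_trans xe).
apply: (@le_lt_trans _ _ (`|c| * e)); first by rewrite ler_wpM2l// ltW.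
by rewrite /e ltr_pdivrMr ?ltr_pwDl// mul1r ltrDr.
Unshelve. all: by end_near.
Qed.

Lemma sums_sq_near0M (R : realType) (a b : fps R) (f g : R -> R) :
  sums_sq_near0 a f -> sums_sq_near0 b g -> sums_sq_near0 (a * b) (fun x => f x * g x).
Proof.
move=> [[A [r [r0 ha]]] sa] [[B [s [s0 hb]]] sb].
pose t := r + s; have t0 : 0 <= t by rewrite addr_ge0.
have {}ha : geometric_bound A t a.
  by apply: geometric_bound_le ha; rewrite r0 lerDl.
have {}hb : geometric_bound B t b.
  by apply: geometric_bound_le hb; rewrite s0 lerDr.
split; first by exists (A * B), (2 * t); split; [rewrite mulr_ge0|exact: geometric_boundM].
near=> x; apply: (fps_sumsM t0 ha hb); last 2 first.
- by near: x.
- by near: x.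
- by near: x; exact: dnbhs0_sqr_lt.
Unshelve. all: by end_near.
Qed.

Lemma sums_sq_near01 (R : realType) : sums_sq_near0 (1 : fps R) (fun=> 1).
Proof.
split; last by near=> x; exact: fps_sums1.
exists 1, 1; split => // k; rewrite expr1n mulr1 fps1.
by case: eqP; rewrite ?normr1 ?normr0.
Unshelve. all: by end_near.
Qed.

Lemma sums_sq_near0X (R : realType) (a : fps R) (f : R -> R) n :
  sums_sq_near0 a f -> sums_sq_near0 (a ^+ n) (fun x => f x ^+ n).
Proof.
move=> sa; elim: n => [|n IH]; first exact: sums_sq_near01.
rewrite (_ : (fun x => _) = (fun x => f x * f x ^+ n)).
  by rewrite exprS; exact: sums_sq_near0M.
by apply/funext => x; rewrite exprS.
Qed.

Lemma geometric_bound_sums (R : realType) (A r : R) (a : fps R) (y : R) :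
  0 <= r -> geometric_bound A r a -> r * `|y| < 1 -> exists l, fps_sums a y l.
Proof.
move=> r0 ha ry; pose u k := a k * y ^+ k.
have /cvg_ex[l ul] : cvgn (series u).
  apply: normed_cvg.
  apply: (@series_le_cvg _ _ (geometric A (r * `|y|))) => [k|k|k|] /=.
  - by [].
  - by rewrite mulr_ge0 ?(geometric_bound_ge0 ha)// exprn_ge0// mulr_ge0.
  - by rewrite /u normrM normrX exprMn mulrA ler_wpM2r ?exprn_ge0.
  - by apply: is_cvg_geometric_series; rewrite ger0_norm// mulr_ge0.
by exists l.
Qed.

(** Replacing x^2 by -x^2 turns sinh(x)/x into sin(x)/x. *)
Definition sinc (R : realType) : fps R := fps_scale (- 1) (sinhc R).
Definition inv_sinc (R : realType) : fps R := fps_scale (- 1) (fps_inv (sinhc R)).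

Lemma sincV (R : realType) : sinc R * inv_sinc R = 1.
Proof.
by rewrite -fps_scaleM fps_mulV ?fps_scale1// /sinhc muln0 invr1.
Qed.

Lemma sinhc_le (R : realType) k : 0 <= sinhc R k <= (2^-1) ^+ k.
Proof.
rewrite /sinhc invr_ge0 ler0n exprVn lef_pV2 ?posrE ?exprn_gt0// ?ltr0n ?fact_gt0//.
rewrite -natrX ler_nat; elim: k => // k IH.
rewrite (_ : (2 * k.+1).+1 = (2 * k).+3)%N; last by lia.
rewrite expnS factS leq_mul//.
by rewrite (leq_trans IH)// leq_pfact.
Qed.

(** By strong induction: the coefficients of [sinhc] are at most 2^-j, and the recursion sums them
    over j >= 1 only. *)
Lemma fps_inv_sinhc_le1 (R : realType) k : `|fps_inv (sinhc R) k| <= 1.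
Proof.
elim/ltn_ind: k => -[|k] IH; first by rewrite /fps_inv/= normr1.
rewrite fps_invS normrN; apply: le_trans (ler_norm_sum _ _ _) _.
apply: (@le_trans _ _ (\sum_(j < k.+1) (2^-1) ^+ j.+1)).
  apply: ler_sum => j _; rewrite normrM -[leRHS]mulr1.
  have /andP[s0 s1] := sinhc_le R j.+1.
  by apply: ler_pM => //; [rewrite ger0_norm|apply: IH; rewrite ltnS leq_subr].
suff -> : \sum_(j < k.+1) (2^-1) ^+ j.+1 = 1 - (2^-1) ^+ k.+1 :> R.
  by rewrite gerBl exprn_ge0.
elim: k {IH} => [|k IH]; first by rewrite big_ord1 expr1; lra.
by rewrite big_ord_recr/= IH; rewrite [_ ^+ k.+2]exprS; lra.
Qed.

Lemma norm_fps_scaleN1 (R : realType) (a : fps R) k :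
  `|fps_scale (- 1) a k| = `|a k|.
Proof. by rewrite /fps_scale normrM normrX normrN1 expr1n mul1r. Qed.

Lemma sums_sinc (R : realType) : sums_sq_near0 (sinc R) (fun x => sin x / x).
Proof.
split.
  exists 1, 1; split => // k; rewrite norm_fps_scaleN1 expr1n mulr1.
  have /andP[s0 s1] := sinhc_le R k; rewrite ger0_norm// (le_trans s1)//.
  by rewrite exprn_ile1//; lra.
near=> x; have x0 : x != 0 by near: x; exact: nbhs_dnbhs_neq.
rewrite /fps_sums (_ : (fun N => _) = (fun N => series (sin_coeff' x) N / x)).
  by apply: cvgMr_tmp; exact: cvg_sin_coeff'.
apply/funext => N; rewrite /series/= mulr_suml; apply: eq_bigr => k _.
rewrite /sin_coeff' /sinc /fps_scale /sinhc -exprM mul2n exprS -exprnP.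
by field; rewrite x0 pnatr_eq0 -lt0n fact_gt0.
Unshelve. all: by end_near.
Qed.

(** Bounded coefficients give some sum l near 0. The Cauchy product with the series of sin(x)/x is
    1, so l is the reciprocal and sin(x) is nonzero. *)
Lemma sums_inv_sinc (R : realType) : sums_sq_near0 (inv_sinc R) (fun x => x / sin x).
Proof.
have hb : geometric_bound 1 1 (inv_sinc R).
  by move=> k; rewrite norm_fps_scaleN1 expr1n mulr1 fps_inv_sinhc_le1.
have [[A [r [r0 ha]]] ss] := sums_sinc R.
pose t := r + 1; have t0 : 0 <= t by rewrite addr_ge0.
have ha' : geometric_bound A t (sinc R).
  by apply: geometric_bound_le ha; rewrite r0 lerDl ler01.
have hb' : geometric_bound 1 t (inv_sinc R).
  by apply: geometric_bound_le hb; rewrite ler01 lerDr.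
split; first by exists 1, 1.
near=> x; have x0 : x != 0 by near: x; exact: nbhs_dnbhs_neq.
have sx : fps_sums (sinc R) (x ^+ 2) (sin x / x) by near: x.
have tx : 4 * t * `|x ^+ 2| < 1 by near: x; exact: dnbhs0_sqr_lt.
have [l sl] : exists l, fps_sums (inv_sinc R) (x ^+ 2) l.
  by apply: geometric_bound_sums hb _ => //; near: x; exact: dnbhs0_sqr_lt.
have := fps_sumsM t0 ha' hb' tx sx sl; rewrite sincV => s1.
have e : 1 = sin x / x * l := cvg_unique (@norm_hausdorff _ R^o) (@fps_sums1 R (x ^+ 2)) s1.
have sin0 : sin x != 0.
  by apply: contra_neq (@oner_neq0 R) => s0; rewrite [LHS]e s0 !mul0r.
suff -> : x / sin x = l by [].
by rewrite -[LHS]mulr1 e; field; rewrite x0 sin0.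
Unshelve. all: by end_near.
Qed.

(** Convergence at one nonzero point bounds all coefficients geometrically. Where the sum is 0, the
    constant term is minus the tail, hence at most a constant times x^2, and x may tend to 0. *)
Lemma fps_sums_sq0_coef0 (R : realType) (d : fps R) :
  (\forall x \near (0 : R)^', fps_sums d (x ^+ 2) 0) -> d 0%N = 0.
Proof.
move=> /= d0.
have [x0 [x0_neq0 sx0]] : exists x, x != 0 /\ fps_sums d (x ^+ 2) 0.
  suff /filter_ex[x [xn sx]] : \forall x \near (0 : R)^', x != 0 /\ fps_sums d (x ^+ 2) 0.
    by exists x.
  near=> x; split; first by near: x; exact: nbhs_dnbhs_neq.
  by near: x.
pose u k := d k * (x0 ^+ 2) ^+ k.
have u0 : u @ \oo --> 0 by apply: cvg_series_cvg_0; apply/cvg_ex; exists 0.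
have [C C0 uC] : exists2 C, 0 <= C & forall k, `|u k| <= C.
  have [M [_ MC]] : bounded_fun u by apply: cvg_seq_bounded; apply/cvg_ex; exists 0.
  exists `|M + 1|; rewrite // => k.
  by apply: le_trans (MC (M + 1) _ k I) (ler_norm _); rewrite ltrDl.
have dC k : `|d k| <= C * (x0 ^- 2) ^+ k.
  have y0 : 0 < (x0 ^+ 2) ^+ k by rewrite exprn_gt0// exprn_even_gt0.
  rewrite exprVn -ler_pdivrMr ?invr_gt0// invrK.
  by apply: le_trans (uC k); rewrite /u normrM (ger0_norm (ltW y0)).
pose r := x0 ^- 2; have r0 : 0 <= r by rewrite invr_ge0 exprn_even_ge0.
have bound (x : R) : 2 * r * `|x ^+ 2| < 1 -> fps_sums d (x ^+ 2) 0 ->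
    `|d 0%N| <= 2 * C * r * `|x ^+ 2|.
  set y := x ^+ 2 => ry sx.
  pose t := r * `|y|; have t0 : 0 <= t by rewrite mulr_ge0.
  have t1 : 2 * t < 1 by rewrite /t mulrA.
  have tail N : `|d 0%N - \sum_(0 <= k < N.+1) d k * y ^+ k| <= 2 * C * t.
    rewrite big_nat_recl// expr0 mulr1 opprD addrA subrr sub0r normrN.
    apply: le_trans (ler_norm_sum _ _ _) _.
    apply: (@le_trans _ _ (\sum_(0 <= k < N) C * t * (2^-1) ^+ k)).
      apply: ler_sum => k _; rewrite normrM normrX.
      apply: (@le_trans _ _ (C * r ^+ k.+1 * `|y| ^+ k.+1)).
        by rewrite ler_wpM2r ?exprn_ge0// -exprVn.
      rewrite -mulrA -exprMn -/t exprS mulrA ler_wpM2l ?mulr_ge0//.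
      by rewrite lerXn2r// ?nnegrE//; lra.
    rewrite -mulr_sumr.
    have -> : \sum_(0 <= k < N) (2^-1) ^+ k = 2 - 2 * (2^-1) ^+ N :> R.
      elim: N => [|N IH]; first by rewrite big_geq// expr0; lra.
      by rewrite big_nat_recr//= IH exprS; lra.
    by rewrite mulrBr mulrC -!mulrA gerBl !mulr_ge0// exprn_ge0.
  have : `|d 0%N - \sum_(0 <= k < N.+1) d k * y ^+ k| @[N --> \oo] --> `|d 0%N - 0|.
    apply: cvg_norm; apply: cvgB; first exact: cvg_cst.
    by move: sx; rewrite /fps_sums -cvg_shiftS.
  rewrite subr0 => /cvgr_to_le; apply; near=> N.
  by rewrite -mulrA; exact: tail.
apply/eqP; rewrite -normr_le0; apply/ler_addgt0Pr => e e0; rewrite add0r.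
have [x [xr xe sx]] : exists x, [/\ 2 * r * `|x ^+ 2| < 1,
    2 * C * r / e * `|x ^+ 2| < 1 & fps_sums d (x ^+ 2) 0].
  suff /filter_ex[x ?] : \forall x \near (0 : R)^', [/\ 2 * r * `|x ^+ 2| < 1,
    2 * C * r / e * `|x ^+ 2| < 1 & fps_sums d (x ^+ 2) 0] by exists x.
  near=> x; split; near: x => //; exact: dnbhs0_sqr_lt.
apply: le_trans (bound _ xr sx) _.
by move: xe; rewrite mulrAC ltr_pdivrMr// mul1r => /ltW.
Unshelve. all: by end_near.
Qed.

(** Once the constant term is 0, division by x^2 shifts the series. *)
Lemma fps_sums_sq0 (R : realType) (d : fps R) :
  (\forall x \near (0 : R)^', fps_sums d (x ^+ 2) 0) -> forall k, d k = 0.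
Proof.
move=> d0 k; elim: k d d0 => [|k IH] d d0; first exact: fps_sums_sq0_coef0.
apply: (IH (fun i => d i.+1)); near=> x.
have x0 : x != 0 by near: x; exact: nbhs_dnbhs_neq.
have sx : fps_sums d (x ^+ 2) 0 by near: x.
rewrite /fps_sums -[X in _ --> X](mul0r (x ^- 2)) (_ : (fun N => _) =
   (fun N => (\sum_(0 <= k < N.+1) d k * (x ^+ 2) ^+ k) * x ^- 2)).
  by apply: cvgMr_tmp; move: sx; rewrite /fps_sums -cvg_shiftS.
apply/funext => N; rewrite big_nat_recl// (fps_sums_sq0_coef0 d0) mul0r add0r.
rewrite mulr_suml; apply: eq_bigr => i _.
by rewrite [_ ^+ i.+1]exprSr mulrA mulfK// expf_neq0.
Unshelve. all: by end_near.
Qed.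

Lemma laurent_inv_sinE (R : realType) n (b : nat -> R) :
  laurent_inv_sin n b <->
  \forall x \near (0 : R)^', fps_sums b (x ^+ 2) ((x / sin x) ^+ n).
Proof.
have term (x : R) k : x != 0 ->
    x ^ ((2 * k)%N%:Z - n%:Z) * b k = b k * (x ^+ 2) ^+ k * x ^- n.
  by move=> x0; rewrite expfzDr// -exprnN -exprnP exprM mulrC mulrA.
split=> h; near=> x.
- have x0 : x != 0 by near: x; exact: nbhs_dnbhs_neq.
  have : (\sum_(0 <= k < N) x ^ ((2 * k)%N%:Z - n%:Z) * b k) @[N --> \oo] --> (1 / sin x) ^+ n.
    by near: x.
  move=> /cvgMr_tmp - /(_ (x ^+ n)).
  rewrite -exprMn mul1r mulrC /fps_sums.
  rewrite (_ : (fun N => _) =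
    (fun N => \sum_(0 <= k < N) b k * (x ^+ 2) ^+ k))//.
  apply/funext => N; rewrite mulr_suml; apply: eq_bigr => k _.
  by rewrite term// mulfVK// expf_neq0.
- have x0 : x != 0 by near: x; exact: nbhs_dnbhs_neq.
  have : fps_sums b (x ^+ 2) ((x / sin x) ^+ n) by near: x.
  move=> /cvgMr_tmp - /(_ (x ^- n)).
  rewrite -exprVn -exprMn mulrAC divff//.
  rewrite (_ : (fun N => _) =
    (fun N => \sum_(0 <= k < N) x ^ ((2 * k)%N%:Z - n%:Z) * b k))//.
  apply/funext => N; rewrite mulr_suml; apply: eq_bigr => k _.
  by rewrite term// exprVn.
Unshelve. all: by end_near.
Qed.

Lemma laurent_inv_sin_exists (R : realType) n : laurent_inv_sin n (inv_sinc R ^+ n).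
Proof. by apply/laurent_inv_sinE; have [_] := sums_sq_near0X n (sums_inv_sinc R). Qed.

Lemma laurent_inv_sin_unique (R : realType) n (b : nat -> R) :
  laurent_inv_sin n b -> forall k, b k = (-1) ^+ k * (fps_inv (sinhc R) ^+ n) k.
Proof.
move=> /laurent_inv_sinE hb k; apply/eqP; rewrite -subr_eq0; apply/eqP.
have /laurent_inv_sinE hs := laurent_inv_sin_exists R n.
have := @fps_sums_sq0 R ((b : fps R) - inv_sinc R ^+ n) _ k.
rewrite fpsD fpsN /inv_sinc -fps_scaleX /fps_scale; apply.
near=> x; rewrite /fps_sums -[X in _ --> X](subrr ((x / sin x) ^+ n)).
rewrite (_ : (fun N => _) = (fun N => \sum_(0 <= k < N) b k * (x ^+ 2) ^+ k -
   \sum_(0 <= k < N) (inv_sinc R ^+ n) k * (x ^+ 2) ^+ k)).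
  by apply: cvgB; near: x.
apply/funext => N; rewrite -sumrB; apply: eq_bigr => i _.
by rewrite -fps_scaleX fpsD fpsN mulrBl.
Unshelve. all: by end_near.
Qed.

(** * The closed formula for the coefficients *)

Lemma fps_inv_sinhc_power_coef (R : realType) n k : (0 < n)%N ->
  (fps_inv (sinhc R) ^+ n) k = ratr
            (('C(n + 2 * k, n))%:R *
             \sum_(0 <= l < (2 * k).+1)
               (n%:R / (n + l)%N%:R) * ('C(2 * k, l))%:R *
               (1 / (2 ^+ l * ((2 * k + l)`!)%:R)) *
               \sum_(0 <= r < l.+1)
                 (-1) ^+ r * ('C(l, r))%:R *
                 (2 * r%:R - l%:R) ^+ (2 * k + l)
             : rat).
Proof.
case: n => // n _.
have -> : (fps_inv (sinhc R) ^+ n.+1) k = (inv_xsinhc R ^+ n.+1) (2 * k)%N.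
  by rewrite /inv_xsinhc -fps_sqX /fps_sq mul2n odd_double doubleK.
have h0 : xsinhc R 0%N = 1 by rewrite /xsinhc /fps_sq /sinhc/= muln0 invr1.
rewrite (inv_power_coef n (2 * k) (xsinhcV R) h0).
rewrite rmorphM/= rmorph_sum/= ratr_nat big_mkord mulr_sumr.
apply: eq_bigr => l _; set N := (2 * k)%N.
have lN : (l <= N)%N by rewrite -ltnS.
rewrite xsinhc_power_coef !(rmorphM, fmorphV)/= rmorphXn/= !ratr_nat.
rewrite rmorph1 mul1r rmorph_sum/= big_mkord.
(* The sign (-1)^l of [inv_power_coef] is hidden in the base 2r - l, because N is even. *)
have -> : \sum_(r < l.+1) ratr ((-1) ^+ r * 'C(l, r)%:R * (2 * r%:R - l%:R) ^+ (N + l)) =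
   (-1) ^+ l * \sum_(r < l.+1) (-1) ^+ r * 'C(l, r)%:R * (l%:R - 2 * r%:R) ^+ (N + l) :> R.
  rewrite mulr_sumr; apply: eq_bigr => r _.
  rewrite !rmorphM/= !rmorphXn/= rmorphB/= rmorphM/= rmorphN1 !ratr_nat.
  rewrite -[2 * r%:R - l%:R]opprB (exprNn (l%:R - _)).
  have -> : (-1) ^+ (N + l) = (-1) ^+ l :> R.
    by rewrite exprD /N exprM sqrrN expr1n expr1n mul1r.
  by rewrite mulrCA.
(* Both sides are (n + 1 + N)! / (n! l! (N - l)!). *)
have e : ('C(n + l, l) * 'C(n.+1 + N, n.+1 + l) * (n.+1 + l) =
    'C(n.+1 + N, n.+1) * n.+1 * 'C(N, l))%N.
  have f0 := fact_gt0.
  have e1 := @bin_fact (n + l) l ltac:(lia); rewrite addnK in e1.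
  have e2 := @bin_fact (n.+1 + N) (n.+1 + l) ltac:(lia); rewrite subnDl in e2.
  have e3 := @bin_fact (n.+1 + N) n.+1 ltac:(lia); rewrite addKn in e3.
  have e4 := bin_fact lN.
  have e5 : ((n.+1 + l)`! = (n.+1 + l) * (n + l)`!)%N by rewrite addSn factS.
  have e6 := factS n.
  apply/eqP; rewrite -(eqn_pmul2r (f0 n)) -(eqn_pmul2r (f0 l)).
  rewrite -(eqn_pmul2r (f0 (N - l)%N)); apply/eqP.
  transitivity (n.+1 + N)`!.
    by rewrite -e2 e5 -e1; ring.
  by rewrite -e3 e6 -e4; ring.
have e' : ('C(n + l, l) * 'C(n.+1 + N, n.+1 + l))%:R =
   'C(n.+1 + N, n.+1)%:R * n.+1%:R * 'C(N, l)%:R / (n.+1 + l)%:R :> R.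
  by apply: (canRL (mulfK _)); rewrite ?pnatr_eq0// -!natrM e.
rewrite -natrM e'.
by move: ((_ * _)^-1) (_ ^-1) (\sum_(_ < _) _) => a b c; ring.
Qed.

Theorem theorem2 (R : realType) (n : nat) (m : 'I_n -> nat)
    (n_gt0 : (0 < n)%N) (m_gt0 : forall j, (0 < m j)%N) :
  [/\
      forall (d : measure_display) (T : measurableType d)
        (P : probability T R) (X : 'I_n -> {RV P >-> R}),
        mutually_independent X ->
        (forall j, has_mass_function P (X j) (chi R (m j))) ->
        has_mass_function P (fun w => \sum_(j < n) X j w) (g R m),
      (exists b : nat -> R, laurent_inv_sin n b) &
      forall b : nat -> R, laurent_inv_sin n b ->
        (forall p : int,
          g R m p =
          (\prod_(j < n) ((2 * m j + 1)%N%:R)^-1) / 2 ^+ n *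
          \sum_(e : {ffun 'I_n -> bool})
            Num.sg ((signed_sum m e p)%:~R) * (\prod_(j < n) (-1) ^+ e j) *
            \sum_(0 <= k < ((n - 1) %/ 2).+1)
              (-1) ^+ k * b k *
              ((signed_sum m e p)%:~R ^+ (n - 2 * k - 1)
                 / ((n - 2 * k - 1)`!)%:R)) /\
        (forall k : nat,
          b k = ratr
            ((-1) ^+ k * ('C(n + 2 * k, n))%:R *
             \sum_(0 <= l < (2 * k).+1)
               (n%:R / (n + l)%N%:R) * ('C(2 * k, l))%:R *
               (1 / (2 ^+ l * ((2 * k + l)`!)%:R)) *
               \sum_(0 <= r < l.+1)
                 (-1) ^+ r * ('C(l, r))%:R *
                 (2 * r%:R - l%:R) ^+ (2 * k + l)
             : rat))].
Proof.
split; first by move=> d T P X; exact: has_mass_function_sum.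
  by exists (inv_sinc R ^+ n); exact: laurent_inv_sin_exists.
move=> b /laurent_inv_sin_unique bE; split=> [p|k]; last first.
  rewrite bE fps_inv_sinhc_power_coef// -mulrA [in RHS]rmorphM/=.
  by rewrite rmorphXn/= rmorphN1.
rewrite g_sinh_res//; congr (_ * _); apply: eq_bigr => e _; congr (_ * _).
case: n n_gt0 m m_gt0 b bE e => // n _ m _ b bE e.
rewrite sinh_res_sum subn1; apply: eq_bigr => k _.
(* The sign (-1)^k in [b k] cancels the one in the formula. *)
by rewrite bE signrMK subn1 -subnS subSS.
Qed.
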